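(* Let $G$ be a finite group and $k$ a field of characteristic $p$ ($p=0$ or $p$ prime). There exist non-isomorphic finite $G$-sets that are linearly equivalent over $k$ if and only if $G$ is not cyclic mod $p$.
   Context: For a $G$-set $X$, $k[X]$ denotes the permutation module of maps $X\to k$, a module over the group algebra $kG$. Two finite $G$-sets $X,Y$ are linearly equivalent over $k$ if $k[X]\cong k[Y]$ as $kG$-modules. For $p$ prime, a finite group is called cyclic mod $p$ if it has a normal $p$-subgroup with cyclic quotient; ''cyclic mod $0$'' means cyclic. *)

(* Defs.v *)
From HB Require Import structures.
From mathcomp Require Import all_boot all_order all_algebra all_fingroup all_solvable.

Set Implicit Arguments.
Unset Strict Implicit.
Unset Printing Implicit Defensive.

Import GroupScope GRing.Theory.
Local Open Scope ring_scope.

Definition has_characteristic (k : fieldType) (p : nat) : Prop :=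
  if p == 0%N then [pchar k] =i pred0 else p \in [pchar k].

Definition cyclic_mod (p : nat) (gT : finGroupType) (G : {group gT}) : bool :=
  if p == 0%N then cyclic G
  else [exists P : {group gT}, [&& P <| G, p.-group P & cyclic (G / P)%g]].

(* MathComp actions are right actions; [gact X x g] stands for [x . g].  The    *)
(* corresponding left action is [g . x = x . g^-1].                            *)
Record gset (gT : finGroupType) := GSet {
  gset_sort :> finType;
  gact : {action gT &-> gset_sort}
}.

Definition gset_iso (gT : finGroupType) (X Y : gset gT) : Prop :=
  exists2 f : X -> Y, bijective f & morph_act (gact X) (gact Y) f id.

(* An element [a] of kG stands for the formal sum of the [a g] g.              *)
Definition group_algebra (k : fieldType) (gT : finGroupType) : Type :=
  {ffun gT -> k}.

Section GroupAlgebra.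

Variables (k : fieldType) (gT : finGroupType).
Local Notation kG := (group_algebra k gT).
Implicit Types a b c : kG.

HB.instance Definition _ := GRing.Zmodule.copy kG {ffun gT -> k}.

Definition ga_one : kG := [ffun g => (g == 1%g)%:R].
Definition ga_mul a b : kG := [ffun g => \sum_h a h * b (h^-1 * g)%g].

Lemma ga_mulA : associative ga_mul.
Proof.
move=> a b c; apply/ffunP=> g; rewrite !ffunE.
under eq_bigr => h _ do rewrite ffunE mulr_sumr.
under [RHS]eq_bigr => h _ do rewrite ffunE mulr_suml.
rewrite [RHS]exchange_big /=; apply: eq_bigr => h _.
rewrite [RHS](reindex_inj (mulgI h)) /=; apply: eq_bigr => x _.
by rewrite mulKg invMg mulgA mulrA.
Qed.

Lemma ga_mul1 : left_id ga_one ga_mul.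
Proof.
move=> a; apply/ffunP=> g; rewrite ffunE (bigD1 1%g) //= ffunE eqxx mul1r.
rewrite invg1 mul1g big1 ?addr0 // => h /negPf h1.
by rewrite ffunE h1 mul0r.
Qed.

Lemma ga_mulr1 : right_id ga_one ga_mul.
Proof.
move=> a; apply/ffunP=> g; rewrite ffunE (bigD1 g) //= ffunE mulVg eqxx mulr1.
rewrite big1 ?addr0 // => h h1.
by rewrite ffunE -eq_mulVg1 (negPf h1) mulr0.
Qed.

Lemma ga_mulDl : left_distributive ga_mul +%R.
Proof.
move=> a b c; apply/ffunP=> g; rewrite !ffunE -big_split /=.
by apply: eq_bigr => h _; rewrite ffunE mulrDl.
Qed.

Lemma ga_mulDr : right_distributive ga_mul +%R.
Proof.
move=> a b c; apply/ffunP=> g; rewrite !ffunE -big_split /=.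
by apply: eq_bigr => h _; rewrite ffunE mulrDr.
Qed.

Lemma ga_one_neq0 : ga_one != 0.
Proof.
by apply/eqP=> /ffunP/(_ 1%g); rewrite !ffunE eqxx => /eqP; rewrite oner_eq0.
Qed.

HB.instance Definition _ := GRing.Zmodule_isNzRing.Build kG
  ga_mulA ga_mul1 ga_mulr1 ga_mulDl ga_mulDr ga_one_neq0.

End GroupAlgebra.

Definition perm_module (k : fieldType) (gT : finGroupType) (X : gset gT) : Type :=
  {ffun X -> k}.

Section PermModule.

Variables (k : fieldType) (gT : finGroupType) (X : gset gT).
Local Notation kG := (group_algebra k gT).
Local Notation kX := (perm_module k X).

HB.instance Definition _ := GRing.Zmodule.copy kX {ffun X -> k}.

(* Since [x . g = g^-1 . x], a group element acts by                           *)
(* [(g f)(x) = f (g^-1 . x) = f (x . g)], which is a left action on maps.      *)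
Definition pm_scale (a : kG) (f : kX) : kX :=
  [ffun x => \sum_g a g * f (gact X x g)].

Lemma pm_scaleA (a b : kG) (f : kX) :
  pm_scale a (pm_scale b f) = pm_scale (a * b) f.
Proof.
apply/ffunP=> x; rewrite !ffunE.
under eq_bigr => g _ do rewrite ffunE mulr_sumr.
under [RHS]eq_bigr => g _ do rewrite ffunE mulr_suml.
rewrite [RHS]exchange_big /=; apply: eq_bigr => g _.
rewrite [RHS](reindex_inj (mulgI g)) /=; apply: eq_bigr => h _.
by rewrite mulKg mulrA actM.
Qed.

Lemma pm_scale1 : left_id 1 pm_scale.
Proof.
move=> f; apply/ffunP=> x; rewrite ffunE (bigD1 1%g) //= ffunE eqxx mul1r act1.
rewrite big1 ?addr0 // => g /negPf g1.
by rewrite ffunE g1 mul0r.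
Qed.

Lemma pm_scaleDr : right_distributive pm_scale +%R.
Proof.
move=> a f f'; apply/ffunP=> x; rewrite !ffunE -big_split /=.
by apply: eq_bigr => g _; rewrite ffunE mulrDr.
Qed.

Lemma pm_scaleDl f : {morph pm_scale^~ f : a b / a + b}.
Proof.
move=> a b; apply/ffunP=> x; rewrite !ffunE -big_split /=.
by apply: eq_bigr => g _; rewrite ffunE mulrDl.
Qed.

HB.instance Definition _ := GRing.Zmodule_isLmodule.Build kG kX
  pm_scaleA pm_scale1 pm_scaleDr pm_scaleDl.

End PermModule.

Definition linearly_equivalent (k : fieldType) (gT : finGroupType)
    (X Y : gset gT) : Prop :=
  exists phi : {linear perm_module k X -> perm_module k Y}, bijective phi.

(* Main.v *)
Require Import Defs.
From mathcomp Require Import all_boot all_order all_algebra all_fingroup all_solvable.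
From HB Require Import structures.
(* Imported again because [gact] also names a projection of groupAction.       *)
Require Import Defs.

Set Implicit Arguments.
Unset Strict Implicit.
Unset Printing Implicit Defensive.

Import GroupScope GRing.Theory.
Local Open Scope ring_scope.

(* If G is cyclic mod p, so is every subgroup K: it has a normal p-subgroup P  *)
(* with K/P cyclic. An isomorphism k[X] = k[Y] is a pair of inverse            *)
(* G-invariant matrices, and in characteristic p their restrictions to the     *)
(* P-fixed points are still inverse to each other. Hence X^P and Y^P have the  *)
(* same number of K-orbits; by Burnside's lemma and induction on K, X and Y    *)
(* have the same numbers of K-fixed points for all K, so they are isomorphic.  *)
(*                                                                             *)
(* If G is not cyclic mod p, then for some prime q <> p either G has a         *)
(* noncyclic q-subgroup, or an element of G acts nontrivially by conjugation   *)
(* on a subgroup of order q: otherwise, by Burnside's transfer theorem, the    *)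
(* derived subgroup is a p-group, and G modulo a Sylow p-subgroup is an        *)
(* abelian group with cyclic Sylow subgroups. So a subgroup H of G has a       *)
(* quotient H/D = C_q x C_q or C_q : C_r (r prime, faithful action), and with  *)
(* K/D = C_q and complements M_i of K/D,                                       *)
(*   k[G/D] + r k[G/H] = k[G/K] + sum_(i < r) k[G/M_i],                        *)
(* by a Vandermonde determinant over k[C_q].                                   *)

(** * Fixed points of linearly equivalent G-sets *)

(** In characteristic p, restricting an invertible intertwining matrix to the points fixed by a
    p-subgroup keeps it invertible ([sum_fixed_points], [fixed_orbits_le]). When G is cyclic mod p,
    orbit counting turns this into equality of all fixed-point numbers ([card_fix_eq]), and these
    determine a G-set ([equal_marks_iso]).

    Conversely, [cyclic_mod_criterion] finds one of two obstructions in a group that is not cyclic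
    mod p, and [coset_relation] turns either into a relation built directly from cosets in G. Both
    sides of the relation have equal dimension. The explicit map between them is injective: q is
    invertible in k, and left translation by n acts like a primitive q-th root of unity on functions
    of trace zero, so the kernel equations form a Vandermonde system. *)

Section IntertwiningMatrix.

Variables (k : fieldType) (gT : finGroupType) (X Y : gset gT).
Implicit Type f : perm_module k X.

Definition intertwining (N : X -> Y -> k) : Prop :=
  forall g x y, N (gact X x g) (gact Y y g) = N x y.

Definition indicator (x : X) : perm_module k X := [ffun z => (z == x)%:R].

(** Maps carry only a kG-module structure here, so a scalar c of k enters as the multiple c 1 of the
    identity of G. *)
Definition ga_elt (c : k) (g : gT) : group_algebra k gT :=
  [ffun h => if h == g then c else 0].

Lemma scale_ga_eltE (Z : gset gT) c g (f : perm_module k Z) z :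
  (ga_elt c g *: f) z = c * f (gact Z z g).
Proof.
rewrite ffunE (bigD1 g) //= ffunE eqxx big1 ?addr0 // => h /negPf hg.
by rewrite ffunE hg mul0r.
Qed.

Lemma sum_indicator f : f = \sum_x ga_elt (f x) 1%g *: indicator x.
Proof.
apply/ffunP=> z; rewrite sum_ffunE (bigD1 z) //= scale_ga_eltE ffunE act1 eqxx.
rewrite mulr1 big1 ?addr0 // => x xz.
by rewrite scale_ga_eltE ffunE act1 eq_sym (negPf xz) mulr0.
Qed.

Variable phi : {linear perm_module k X -> perm_module k Y}.

Definition mx_of_linear (x : X) (y : Y) : k := phi (indicator x) y.

Lemma mx_of_linearE f y : phi f y = \sum_x mx_of_linear x y * f x.
Proof.
rewrite {1}[f]sum_indicator linear_sum sum_ffunE; apply: eq_bigr => x _.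
by rewrite linearZ scale_ga_eltE act1 mulrC.
Qed.

Lemma mx_of_linear_intertwining : intertwining mx_of_linear.
Proof.
move=> g x y; rewrite /mx_of_linear.
suff -> : indicator x = ga_elt 1 g *: indicator (gact X x g).
  by rewrite linearZ scale_ga_eltE mul1r.
apply/ffunP=> z; rewrite scale_ga_eltE !ffunE mul1r.
by rewrite (inj_eq (act_inj (gact X) g)).
Qed.

End IntertwiningMatrix.

Lemma linearly_equivalent_sym (k : fieldType) (gT : finGroupType) (X Y : gset gT) :
  linearly_equivalent k X Y -> linearly_equivalent k Y X.
Proof.
case=> phi [psi phiK psiK].
pose L := GRing.isLinear.Build _ _ _ _ psi (can2_linear phiK psiK).
pose psi' : {linear perm_module k Y -> perm_module k X} := HB.pack psi L.
by exists psi', phi.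
Qed.

Lemma linearly_equivalent_mx (k : fieldType) (gT : finGroupType) (X Y : gset gT) :
  linearly_equivalent k X Y ->
  exists (N : X -> Y -> k) (N' : Y -> X -> k),
   [/\ intertwining N, intertwining N' &
       forall x x', \sum_y N x y * N' y x' = (x == x')%:R].
Proof.
case=> phi [psi phiK psiK].
pose L := GRing.isLinear.Build _ _ _ _ psi (can2_linear phiK psiK).
pose psi' : {linear perm_module k Y -> perm_module k X} := HB.pack psi L.
exists (mx_of_linear phi), (mx_of_linear psi').
split=> [||x x']; try exact: mx_of_linear_intertwining.
have /ffunP/(_ x') := phiK (indicator k x).
rewrite [X in X = _](mx_of_linearE psi') ffunE [in RHS]eq_sym => <-.
by apply: eq_bigr => y _; rewrite mulrC.
Qed.

(* The index condition says that P is a p-group for p = char k, and that P = 1 *)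
(* if char k = 0; orbits of P outside the fixed points then contribute 0.      *)
Lemma sum_fixed_points (k : fieldType) (gT : finGroupType) (P : {group gT})
    (X : gset gT) (w : X -> k) :
    (forall Q : {group gT}, Q \proper P -> #|P : Q|%:R = 0 :> k) ->
    (forall g x, g \in P -> w (gact X x g) = w x) ->
  \sum_x w x = \sum_(x in 'Fix_(gact X)(P)) w x.
Proof.
move=> indexP wP; rewrite [RHS]big_mkcond /=.
have parT : partition (orbit (gact X) P @: setT) [set: X].
  by apply/orbit_partition/actsP=> g _ x; rewrite !inE.
have sumT F : \sum_x F x = \sum_(x in [set: X]) F x :> k.
  by apply: eq_bigl => x; rewrite inE.
rewrite !sumT !(set_partition_big _ parT) /=; apply: eq_bigr => _ /imsetP[x _ ->].
have [fixx | nfixx] := boolP (x \in 'Fix_(gact X)(P)).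
  by rewrite (orbit1P fixx) !big_set1 fixx.
(* A P-fixed point anywhere in the orbit of x would force x to be fixed. *)
rewrite [RHS]big1 => [|y /orbitP[g Pg <-]]; last first.
  case: ifP => // fixy; case/negP: nfixx; apply/afixP=> h Ph.
  apply: (act_inj (gact X) g); have/afixP fy := fixy.
  by rewrite -actM (conjgC h g) actM fy // memJ_norm // (subsetP (normG P)).
(* On this orbit w is constant, and the orbit length is the index of a proper stabiliser, hence 0 in
   k. *)
rewrite (eq_bigr (fun=> w x)) => [|_ /orbitP[g Pg <-]]; last exact: wP.
rewrite sumr_const card_orbit -[w x]mul1r -mulrnAl indexP ?mul0r //.
rewrite properE subsetIl /=; apply: contra nfixx => sPC.
by apply/afixP=> g /(subsetP sPC)/setIP[_ /astab1P].
Qed.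

(** Summing N and N' over orbits gives matrices B and B' with B B' = 1. The identity indexed by the
    orbits of S thus factors through the orbits of T, and ranks compare. *)
Lemma card_orbits_le (k : fieldType) (gT : finGroupType) (K : {group gT})
    (X Y : gset gT) (S : {set X}) (T : {set Y}) (N : X -> Y -> k) (N' : Y -> X -> k) :
    [acts K, on S | gact X] -> [acts K, on T | gact Y] ->
    intertwining N -> intertwining N' ->
    {in S &, forall x x', \sum_(y in T) N x y * N' y x' = (x == x')%:R} ->
  (#|orbit (gact X) K @: S| <= #|orbit (gact Y) K @: T|)%N.
Proof.
move=> actS actT intN intN' NN'.
have repS (i : 'I_#|orbit (gact X) K @: S|) :
    {x | x \in S & enum_val i = orbit (gact X) K x}.
  by apply: sig2_eqW; apply/imsetP/enum_valP.
have repT (j : 'I_#|orbit (gact Y) K @: T|) :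
    {y | y \in T & enum_val j = orbit (gact Y) K y}.
  by apply: sig2_eqW; apply/imsetP/enum_valP.
pose rS i := s2val (repS i); pose rT j := s2val (repT j).
have SrS i : rS i \in S := s2valP (repS i).
have rSE i : enum_val i = orbit (gact X) K (rS i) := s2valP' (repS i).
have rTE j : enum_val j = orbit (gact Y) K (rT j) := s2valP' (repT j).
pose B := \matrix_(i, j) \sum_(x in orbit (gact X) K (rS i)) N x (rT j).
pose B' := \matrix_(j, i) \sum_(y in orbit (gact Y) K (rT j)) N' y (rS i).
apply: (@mulmx1_min k _ _ B B'); apply/matrixP=> i i'; rewrite !mxE.
have Nconst j y : y \in orbit (gact Y) K (rT j) ->
    \sum_(x in orbit (gact X) K (rS i)) N x (rT j)
      = \sum_(x in orbit (gact X) K (rS i)) N x y.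
  case/orbitP=> g Kg <-.
  rewrite [RHS](reindex_inj (act_inj (gact X) g)) /=.
  by apply: eq_big => x; rewrite ?orbit_actr ?intN.
have sOS : {subset orbit (gact X) K (rS i) <= S}.
  by apply/subsetP; rewrite acts_sub_orbit.
transitivity (\sum_(y in T) \sum_(x in orbit (gact X) K (rS i)) N x y * N' y (rS i')).
  rewrite (set_partition_big _ (orbit_partition actT)) /= [RHS]big_enum_val /=.
  apply: eq_bigr => j _; rewrite !mxE big_distrr /= rTE; apply: eq_bigr => y jy.
  by rewrite (Nconst j y jy) big_distrl.
rewrite exchange_big /= (eq_bigr (fun x => (x == rS i')%:R)) => [|x ix]; last first.
  exact: NN' (sOS _ ix) (SrS _).
rewrite -(inj_eq enum_val_inj) !rSE orbit_eq_mem orbit_sym.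
have [Oii' | nOii'] := boolP (rS i' \in _).
  rewrite (bigD1 (rS i')) //= eqxx big1 ?addr0 // => x /andP[_ /negPf->] //.
by rewrite big1 // => x ix; case: eqP nOii' => // <-; rewrite ix.
Qed.

Section FixedOrbits.

Variables (k : fieldType) (gT : finGroupType) (P : {group gT}).
Hypothesis indexP : forall Q : {group gT}, Q \proper P -> #|P : Q|%:R = 0 :> k.

(** For P-fixed x and x', the map y |-> N x y N' y x' is P-invariant. By [sum_fixed_points] only
    fixed y matter, so the restricted matrices still multiply to 1. *)
Lemma fixed_orbits_le (X Y : gset gT) (K : {group gT}) :
    K \subset 'N(P) -> linearly_equivalent k X Y ->
  (#|orbit (gact X) K @: 'Fix_(gact X)(P)|
     <= #|orbit (gact Y) K @: 'Fix_(gact Y)(P)|)%N.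
Proof.
move=> nPK /linearly_equivalent_mx[N [N' [intN intN' NN']]].
apply: (card_orbits_le _ _ intN intN'); try exact: acts_fix_norm.
move=> x x' fix_x fix_x'; rewrite -NN' [RHS](sum_fixed_points indexP) // => g y Pg.
by rewrite -(intN g x y) -(intN' g y x') (afixP fix_x _ Pg) (afixP fix_x' _ Pg).
Qed.

Lemma fixed_orbits_eq (X Y : gset gT) (K : {group gT}) :
    K \subset 'N(P) -> linearly_equivalent k X Y ->
  #|orbit (gact X) K @: 'Fix_(gact X)(P)|
     = #|orbit (gact Y) K @: 'Fix_(gact Y)(P)|.
Proof.
move=> nPK eqXY; apply/eqP; rewrite eqn_leq !fixed_orbits_le //.
exact: linearly_equivalent_sym.
Qed.

Lemma sum_card_fix (X : gset gT) (K : {group gT}) : K \subset 'N(P) ->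
  (\sum_(a in K) #|'Fix_(gact X)(P <*> <[a]>)|
     = #|orbit (gact X) K @: 'Fix_(gact X)(P)| * #|K|)%N.
Proof.
move=> nPK; rewrite -Frobenius_Cauchy ?acts_fix_norm //; apply: eq_bigr => a _.
by rewrite afixYin ?subsetT // afix_cycle.
Qed.

(* Burnside's orbit count for K acting on the P-fixed points involves only the *)
(* subgroups P<a>; the a with P<a> <> K are handled by induction on #|K|.      *)
Lemma card_fix_eq (X Y : gset gT) (K : {group gT}) :
    linearly_equivalent k X Y -> P <| K -> cyclic (K / P)%g ->
  #|'Fix_(gact X)(K)| = #|'Fix_(gact Y)(K)|.
Proof.
move=> eqXY; have [n] := ubnP #|K|; elim: n K => // n IHn K ltKn nPK cycK.
have [sPK nPK'] := andP nPK.
pose F (Z : gset gT) a := #|'Fix_(gact Z)(P <*> <[a]>)|.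
have: (\sum_(a in K) F X a = \sum_(a in K) F Y a)%N.
  by rewrite (sum_card_fix X nPK') (sum_card_fix Y nPK') (fixed_orbits_eq nPK' eqXY).
pose gen_modP a := P <*> <[a]> == K.
have sumF Z : (\sum_(a in K) F Z a = #|[set a in K | gen_modP a]| * #|'Fix_(gact Z)(K)|
                + \sum_(a in K | ~~ gen_modP a) F Z a)%N.
  rewrite (bigID gen_modP) /= -sum_nat_const; congr (_ + _)%N.
  by apply: eq_big => a; rewrite ?inE // => /andP[_ /eqP defK]; rewrite /F defK.
rewrite !sumF (eq_bigr (F Y)).
  move/addIn/eqP; rewrite eqn_pmul2l => [/eqP //|].
  (* The coefficient to cancel is positive: a lift a of a generator of K/P satisfies P<a> = K. *)
  have [u defK] := cyclicP cycK.
  have : u \in (K / P)%g by rewrite defK cycle_id.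
  case/morphimP=> a Na Ka def_u; apply/card_gt0P; exists a.
  rewrite inE Ka; apply/eqP; apply: (quotient_inj (H := P)).
  - by rewrite /normal joing_subl join_subG normG cycle_subG.
  - by [].
  - by rewrite quotientYidl ?cycle_subG // quotient_cycle // defK def_u.
move=> a /andP[Ka neqK].
have sLK : P <*> <[a]> \subset K by rewrite join_subG sPK cycle_subG.
have nPL : P <| P <*> <[a]>.
  by rewrite /normal joing_subl (subset_trans sLK).
apply: IHn => //.
  by apply: (@leq_trans #|K|) => //; apply: proper_card; rewrite properEneq sLK andbT.
by apply: cyclicS cycK; apply: quotientS.
Qed.

End FixedOrbits.

(** * G-sets are determined by their numbers of fixed points *)

Section OrbitTransport.

Variables (gT : finGroupType) (X Y : gset gT) (x : X) (y : Y).
Hypothesis stab_xy : 'C[x | gact X] = 'C[y | gact Y].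

(** This sends x.g to y.g, independently of g because the stabilisers agree. The default 1 is
    reached only off the orbit of x. *)
Definition orbit_transport (z : X) : Y :=
  gact Y y (odflt 1%g [pick g | gact X x g == z]).

Lemma orbit_transport_eq g h :
  (gact X x g == gact X x h) = (gact Y y g == gact Y y h).
Proof.
have shift (Z : gset gT) (z : Z) :
    (gact Z z g == gact Z z h) = (g * h^-1 \in 'C[z | gact Z])%g.
  apply/eqP/astab1P => [e | e]; first by rewrite actM e actK.
  by rewrite -{2}e -actM mulgKV.
by rewrite !shift stab_xy.
Qed.

Lemma orbit_transportE g : orbit_transport (gact X x g) = gact Y y g.
Proof.
rewrite /orbit_transport; case: pickP => [h | /(_ g)]; last by rewrite eqxx.
by rewrite orbit_transport_eq => /eqP.
Qed.

Lemma orbit_transport_inj : {in orbit (gact X) setT x &, injective orbit_transport}.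
Proof.
move=> _ _ /orbitP[g _ <-] /orbitP[h _ <-]; rewrite !orbit_transportE.
by move/eqP; rewrite -orbit_transport_eq => /eqP.
Qed.

Lemma card_orbit_fix (K : {set gT}) :
  #|orbit (gact X) setT x :&: 'Fix_(gact X)(K)|
    = #|orbit (gact Y) setT y :&: 'Fix_(gact Y)(K)|.
Proof.
have fixE g : (gact X x g \in 'Fix_(gact X)(K)) = (gact Y y g \in 'Fix_(gact Y)(K)).
  by apply/afixP/afixP=> fixg a Ka; apply/eqP; have/eqP := fixg a Ka;
    rewrite -!actM orbit_transport_eq.
rewrite -(card_in_imset (f := orbit_transport)); last first.
  by move=> z z' /setIP[xz _] /setIP[xz' _]; apply: orbit_transport_inj.
apply: eq_card => z; apply/imsetP/setIP => [[_ /setIP[/orbitP[g _ <-] fixg] ->] | []].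
  by rewrite orbit_transportE -fixE; split=> //; rewrite mem_orbit ?in_setT.
case/orbitP=> g _ <- fixg; exists (gact X x g); last by rewrite orbit_transportE.
by rewrite in_setI mem_orbit ?in_setT //= fixE.
Qed.

End OrbitTransport.

(** Induction on S: an orbit with largest stabiliser has a twin in T, and removing both preserves
    the equality of fixed-point numbers. The point [y0] is the value of f when S is exhausted. *)
Lemma equal_marks_partial_iso (gT : finGroupType) (X Y : gset gT) (y0 : Y)
    (S : {set X}) (T : {set Y}) :
    [acts [set: gT], on S | gact X] -> [acts [set: gT], on T | gact Y] ->
    (forall K : {group gT}, #|S :&: 'Fix_(gact X)(K)| = #|T :&: 'Fix_(gact Y)(K)|) ->
  exists f : X -> Y,
    [/\ {in S &, injective f}, {in S, forall x, f x \in T} &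
        {in S, forall x g, f (gact X x g) = gact Y (f x) g}].
Proof.
have [n] := ubnP #|S|; elim: n S T => // n IHn S T ltSn actS actT marks.
have [-> | [x1 Sx1]] := set_0Vmem S.
  by exists (fun=> y0); split=> x; rewrite inE.
(* Since the stabiliser of x is maximal, some y in T has exactly this stabiliser. *)
case: (@arg_maxnP _ x1 [in S] (fun x => #|'C[x | gact X]|) Sx1) => x /= Sx max_x {x1 Sx1}.
have [y Ty stab_xy] : exists2 y, y \in T & 'C[x | gact X] = 'C[y | gact Y].
  have : (0 < #|T :&: 'Fix_(gact Y)('C[x | gact X])|)%N.
    by rewrite -marks; apply/card_gt0P; exists x; rewrite in_setI -sub_astab1 subxx andbT.
  case/card_gt0P=> y /setIP[Ty]; rewrite -sub_astab1 => le_xy; exists y => //.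
  apply/eqP; rewrite eqEcard le_xy /=.
  have : (0 < #|S :&: 'Fix_(gact X)('C[y | gact Y])|)%N.
    by rewrite marks; apply/card_gt0P; exists y; rewrite in_setI -sub_astab1 subxx andbT.
  case/card_gt0P=> x' /setIP[Sx']; rewrite -sub_astab1 => /subset_leq_card le_yx'.
  exact: leq_trans le_yx' (max_x x' Sx').
have sOS : orbit (gact X) setT x \subset S by rewrite acts_sub_orbit.
have sOT : orbit (gact Y) setT y \subset T by rewrite acts_sub_orbit.
have actsD (Z : gset gT) (A : {set Z}) z : [acts setT, on A | gact Z] ->
    [acts setT, on A :\: orbit (gact Z) setT z | gact Z].
  move/actsP=> actA; apply/actsP=> g Gg z'.
  by rewrite !inE actA // orbit_actr.
case: (IHn (S :\: orbit (gact X) setT x) (T :\: orbit (gact Y) setT y)).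
- rewrite -ltnS; apply: leq_trans ltSn; rewrite ltnS; apply: proper_card.
  rewrite properEneq subsetDl andbT; apply/eqP=> /setP/(_ x).
  by rewrite inE orbit_refl Sx.
- exact: actsD.
- exact: actsD.
- move=> K; rewrite !setIDAC.
  apply: (@addnI #|orbit (gact X) setT x :&: 'Fix_(gact X)(K)|).
  rewrite {2}(card_orbit_fix stab_xy).
  rewrite -{1}(setIidPr sOS) -{1}(setIidPr sOT).
  by rewrite ![_ :&: orbit _ _ _ :&: _]setIAC !cardsID.
move=> f [injf fST fact].
pose f' z := if z \in orbit (gact X) setT x then orbit_transport x y z else f z.
have fD z : z \in S -> z \notin orbit (gact X) setT x -> f z \notin orbit (gact Y) setT y.
  by move=> Sz nxz; have := fST z; rewrite !inE Sz nxz => /(_ isT)/andP[].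
have trO z : z \in orbit (gact X) setT x -> orbit_transport x y z \in orbit (gact Y) setT y.
  by case/orbitP=> g _ <-; rewrite orbit_transportE // mem_orbit ?in_setT.
exists f'; split.
- move=> z z' Sz Sz'; rewrite /f'.
  case: ifPn => xz; case: ifPn => xz'; first exact: orbit_transport_inj.
  + by move=> e; have := fD _ Sz' xz'; rewrite -e trO.
  + by move=> e; have := fD _ Sz xz; rewrite e trO.
  + by apply: injf; rewrite inE ?xz ?xz'.
- move=> z Sz; rewrite /f'; case: ifPn => xz; first by apply: (subsetP sOT); apply: trO.
  by have := fST z; rewrite !inE Sz xz => /(_ isT)/andP[].
move=> z Sz g; rewrite /f' orbit_actr ?inE //; case: ifPn => xz; last first.
  by apply: fact; rewrite inE xz.
by case/orbitP: xz => h _ <-; rewrite -actM !orbit_transportE // actM.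
Qed.

Lemma equal_marks_iso (gT : finGroupType) (X Y : gset gT) :
    (forall K : {group gT}, #|'Fix_(gact X)(K)| = #|'Fix_(gact Y)(K)|) ->
  gset_iso X Y.
Proof.
move=> marks.
have cardXY : #|X| = #|Y|.
  rewrite -!cardsT; have := marks 1%G.
  suff fix1 (Z : gset gT) : 'Fix_(gact Z)(1%G) = [set: Z] by rewrite !fix1.
  by apply/setP=> z; rewrite [RHS]inE; apply/afixP=> g /set1P->; rewrite act1.
(* An empty Y offers no default value, but then X is empty too. *)
have [y0 _ | noY] := pickP Y; last first.
  have noX (x : X) : False.
    by have : (0 < #|X|)%N; [apply/card_gt0P; exists x | rewrite cardXY eq_card0].
  have noY' (y : Y) : False by have := noY y.
  exists (fun x => match noX x with end); last by move=> x; case: (noX x).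
  by exists (fun y => match noY' y with end) => [x | y]; [case: (noX x) | case: (noY' y)].
have actsT (Z : gset gT) : [acts setT, on [set: Z] | gact Z].
  by apply/actsP=> g _ z; rewrite !inE.
have [|f [injf _ fact]] := equal_marks_partial_iso y0 (actsT X) (actsT Y).
  by move=> K; rewrite !setTI.
exists f; last by move=> x g; rewrite fact ?inE.
by apply: inj_card_bij; [move=> x x'; apply: injf; rewrite inE | rewrite cardXY].
Qed.

Lemma linearly_equivalent_iso (gT : finGroupType) (k : fieldType) (p : nat)
    (X Y : gset gT) :
    has_characteristic k p -> cyclic_mod p [set: gT]%G ->
  linearly_equivalent k X Y -> gset_iso X Y.
Proof.
move=> hk cycG eqXY; apply: equal_marks_iso => K.
have [P [nPG cycGP indexP]] : exists P : {group gT}, [/\ P <| [set: gT], cyclic ([set: gT] / P)%g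
    & forall Q R : {group gT}, R \subset P -> Q \proper R -> #|R : Q|%:R = 0 :> k].
  move: hk cycG; rewrite /has_characteristic /cyclic_mod.
  have [_ _ cycG | _ charp /existsP[P /and3P[nPG pP cycGP]]] := eqVneq p 0%N.
    exists 1%G; split=> [||Q R]; rewrite ?normal1 //.
      exact: quotient_cyclic.
    by move=> sR1 /proper_sub_trans/(_ sR1); rewrite properE sub1G andbF.
  exists P; split=> // Q R sRP ltQR.
  have /p_natP[[|n] oRQ] : p.-nat #|R : Q|.
  - exact: pnat_dvd (dvdn_indexg R Q) (pgroupS sRP pP).
  - by move: oRQ ltQR => /eqP; rewrite indexg_eq1 properE => ->; rewrite andbF.
  - by rewrite oRQ natrX (pcharf0 charp) expr0n.
have nPK : K \subset 'N(P) by apply: subset_trans (normal_norm nPG); apply: subsetT.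
(* K modulo its intersection with P is isomorphic to the image of K in the cyclic group G/P. *)
apply: (card_fix_eq (P := P :&: K)) eqXY _ _ => [Q ltQPK||].
- exact: indexP (subsetIl P K) ltQPK.
- by rewrite /normal subsetIr normsI ?normG.
- rewrite (isog_cyclic (second_isog nPK)); apply: cyclicS cycGP.
  by apply: quotientS; apply: subsetT.
Qed.

(** * Linear equivalences between sets of cosets *)

Lemma bijective_linear_map (k : fieldType) (X Y : finType)
    (phi : {linear {ffun X -> k^o} -> {ffun Y -> k^o}}) :
  (forall f, phi f = 0 -> f = 0) -> #|X| = #|Y| -> bijective phi.
Proof.
move=> ker0 cardXY; pose h := linfun phi.
have hE f : h f = phi f by rewrite lfunE.
have kerh : lker h == 0%VS.
  by apply/lker0P => f g e; apply/eqP; rewrite -subr_eq0; apply/eqP/ker0;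
     rewrite linearB /= -!hE e subrr.
have imh : limg h = fullv.
  apply/eqP; rewrite eqEdim subvf /= limg_dim_eq ?(eqP kerh) ?capv0 //.
  by rewrite !dimvf /dim /= cardXY.
have hK : cancel h (h^-1)%VF by apply: lker0_lfunK.
exists (h^-1)%VF => f; first by rewrite -hE hK.
by rewrite -hE limg_lfunVK // imh memvf.
Qed.

(** The same map is packed twice: as a kG-linear map for the conclusion, and as a k-linear map for
    the dimension count that gives bijectivity. *)
Lemma linearly_equivalent_of_mx (k : fieldType) (gT : finGroupType)
    (X Y : gset gT) (N : X -> Y -> k) :
    intertwining N -> #|X| = #|Y| ->
    (forall f : {ffun X -> k}, (forall y, \sum_x N x y * f x = 0) -> f = 0) ->
  linearly_equivalent k X Y.
Proof.
move=> intN cardXY ker0.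
pose phi (f : {ffun X -> k}) : {ffun Y -> k} := [ffun y => \sum_x N x y * f x].
have lin_phi : linear (phi : perm_module k X -> perm_module k Y).
  move=> a f g; apply/ffunP=> y; rewrite !ffunE.
  under eq_bigr => x _ do rewrite !ffunE mulrDr.
  rewrite big_split /=; congr (_ + _).
  under eq_bigr => x _ do rewrite big_distrr /=.
  rewrite exchange_big /=; apply: eq_bigr => h _.
  rewrite ffunE big_distrr [RHS](reindex_inj (act_inj (gact X) h)) /=.
  by apply: eq_bigr => x _; rewrite intN mulrCA.
have lin_phi_k : linear (phi : {ffun X -> k^o} -> {ffun Y -> k^o}).
  move=> a f g; apply/ffunP=> y; rewrite !ffunE scaler_sumr -big_split /=.
  by apply: eq_bigr => x _; rewrite !ffunE mulrDr; congr (_ + _); apply: mulrCA.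
pose L := GRing.isLinear.Build _ _ _ _ _ lin_phi.
pose Lk := GRing.isLinear.Build _ _ _ _ _ lin_phi_k.
pose phiL : {linear perm_module k X -> perm_module k Y} := HB.pack phi L.
pose phik : {linear {ffun X -> k^o} -> {ffun Y -> k^o}} := HB.pack phi Lk.
exists phiL; apply: (bijective_linear_map (phi := phik)) => // f phif0.
by apply: ker0 => y; have /ffunP/(_ y) := phif0; rewrite !ffunE.
Qed.

(** * Vandermonde elimination with powers of an operator as coefficients *)

Section Vandermonde.

Variables (V : zmodType) (T : {additive V -> V}) (q : nat).
Hypothesis q_prime : prime q.
Hypothesis q_torsion_free : forall v : V, v *+ q = 0 -> v = 0.

(** On these vectors T behaves like a primitive q-th root of unity. *)
Let W v := iter q T v = v /\ \sum_(a < q) iter a T v = 0.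

Lemma iter_additive n : {morph iter n T : u v / u + v}.
Proof. by elim: n => // n IHn u v; rewrite !iterS IHn raddfD. Qed.

Lemma iter_additive0 n : iter n T 0 = 0.
Proof. by elim: n => // n IHn; rewrite iterS IHn raddf0. Qed.

Lemma iter_additiveB n : {morph iter n T : u v / u - v}.
Proof.
by move=> u v; apply/eqP; rewrite eq_sym subr_eq -iter_additive subrK.
Qed.

Lemma iter_sum n I (s : seq I) (F : I -> V) :
  iter n T (\sum_(i <- s) F i) = \sum_(i <- s) iter n T (F i).
Proof. exact: (big_morph _ (iter_additive n) (iter_additive0 n)). Qed.

Lemma iter_mul_fix n c v : iter c T v = v -> iter (n * c) T v = v.
Proof. by move=> fixv; elim: n => // n IHn; rewrite mulSn iterD IHn. Qed.

(** As T^q also fixes v, Bezout gives T v = v. The vanishing trace is then q v. *)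
Lemma fixed_trace0 c v : W v -> ~~ (q %| c)%N -> iter c T v = v -> v = 0.
Proof.
move=> [qv trv] q'c cv; apply: q_torsion_free.
have c_gt0 : (0 < c)%N by case: c q'c {cv}; rewrite ?dvdn0.
have /eqP cop_cq : coprime c q by rewrite coprime_sym prime_coprime.
have [a b eab _] := egcdnP q c_gt0.
have fixv : T v = v.
  have := iter_mul_fix a cv.
  by rewrite eab cop_cq addn1 iterS iter_mul_fix.
rewrite -[RHS]trv -[in LHS](card_ord q) -sumr_const; apply: eq_bigr => i _.
by elim: (i : nat) => // n IHn; rewrite iterS -IHn.
Qed.

Lemma traceless_iter c v : W v -> W (iter c T v).
Proof.
move=> [qv trv]; split; first by rewrite -iterD addnC iterD qv.
transitivity (iter c T (\sum_(a < q) iter a T v)); last by rewrite trv iter_additive0.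
rewrite iter_sum; apply: eq_bigr => a _.
by rewrite -!iterD addnC.
Qed.

Lemma tracelessB u v : W u -> W v -> W (u - v).
Proof.
move=> [qu tru] [qv trv]; split; first by rewrite iter_additiveB qu qv.
under eq_bigr => a _ do rewrite iter_additiveB.
by rewrite sumrB tru trv subrr.
Qed.

(* The determinant of the Vandermonde matrix (T^(i t_j))_ij is a product of    *)
(* differences T^t - T^t', which are injective on the kernel of 1 + ... +      *)
(* T^(q-1) when t <> t' modulo q.                                              *)
Lemma vandermonde_injective (s : seq (nat * V)) :
    uniq [seq (tv.1 %% q)%N | tv <- s] ->
    (forall tv, tv \in s -> W tv.2) ->
    (forall i, (i < size s)%N -> \sum_(tv <- s) iter (i * tv.1) T tv.2 = 0) ->
  forall tv, tv \in s -> tv.2 = 0.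
Proof.
have [n] := ubnP (size s); elim: n s => // n IHn [|[t0 v0] s] //= lt_s_n.
case/andP=> t0's uniq_s Ws eqs.
have W0 : W v0 by apply: (Ws (t0, v0)); rewrite inE eqxx.
have Ws' tv : tv \in s -> W tv.2 by move=> s_tv; apply: Ws; rewrite inE s_tv orbT.
(* Subtracting T^t0 of row i from row i+1 eliminates v0 and leaves a shorter system of the same kind
   in these differences. *)
pose elim0 (tv : nat * V) := (tv.1, iter tv.1 T tv.2 - iter t0 T tv.2).
have s0 tv : tv \in s -> tv.2 = 0.
  move=> s_tv; have /eqP : (elim0 tv).2 = 0.
    apply: (IHn [seq elim0 x | x <- s]); last exact: map_f.
    - by rewrite size_map.
    - by rewrite -map_comp.
    - move=> _ /mapP[x s_x ->]; apply: tracelessB; apply: traceless_iter; exact: Ws'.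
    rewrite size_map => i lt_i_s; rewrite big_map /=.
    have := eqs i.+1 lt_i_s; have := eqs i (ltnW lt_i_s); rewrite !big_cons /=.
    move/(congr1 (iter t0 T)); rewrite iter_additive0 iter_additive iter_sum -iterD.
    rewrite mulSn => /eqP; rewrite addr_eq0 => /eqP-> /eqP; rewrite addrC subr_eq0 => /eqP e.
    under eq_bigr => x _ do rewrite iter_additiveB -!iterD.
    rewrite sumrB; apply/eqP; rewrite subr_eq0; apply/eqP.
    rewrite [RHS](eq_bigr (fun x => iter t0 T (iter (i * x.1) T x.2))) => [|x _].
      by rewrite -e; apply: eq_bigr => x _; rewrite mulSn addnC.
    by rewrite -iterD addnC.
  rewrite subr_eq0 => /eqP e_tv.
  (* The summand (q-1) t0 stands for -t0 modulo q, which keeps the exponent natural. *)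
  apply: (@fixed_trace0 (tv.1 + q.-1 * t0)) (Ws' _ s_tv) _ _; last first.
    rewrite addnC iterD e_tv -iterD -mulSnr prednK ?prime_gt0 //.
    by rewrite mulnC iter_mul_fix //; case: (Ws' _ s_tv).
  apply: contra t0's => /dvdnP[c ec]; apply/mapP; exists tv => //=.
  rewrite -[RHS](modnMDl t0) -(@modnMDl c t0) -ec -addnA -mulSnr.
  by rewrite prednK ?prime_gt0 // addnC mulnC.
have v00 : v0 = 0.
  by have := eqs 0%N isT; rewrite big_cons /= big1_seq ?addr0 // => x /s0.
by move=> tv; rewrite inE => /predU1P[->|/s0].
Qed.

End Vandermonde.

(** * Disjoint unions of coset spaces and a map between two of them *)

Section CosetGset.

Variables (gT : finGroupType) (I : finType) (L : I -> {group gT}).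

(** The tag keeps the union disjoint even when several [L i] coincide. *)
Definition indexed_coset : predArgType :=
  {p : I * {set gT} | p.2 \in rcosets (L p.1) [set: gT]}.

Lemma indexed_coset_act_proof (p : indexed_coset) g :
  (val p).2 :* g \in rcosets (L (val p).1) [set: gT].
Proof.
case: p => -[i A] /= /rcosetsP[x _ ->].
by rewrite -rcosetM; apply/rcosetsP; exists (x * g)%g; rewrite ?inE.
Qed.

Definition indexed_coset_act (p : indexed_coset) (g : gT) : indexed_coset :=
  exist _ ((val p).1, (val p).2 :* g) (indexed_coset_act_proof p g).

Lemma indexed_coset_act1 : indexed_coset_act^~ 1%g =1 id.
Proof. by case=> -[i A] iA; apply: val_inj; rewrite /= rcoset1. Qed.

Lemma indexed_coset_actM p : act_morph indexed_coset_act p.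
Proof. by move=> g h; apply: val_inj; rewrite /= rcosetM. Qed.

Definition coset_gset : gset gT :=
  GSet (TotalAction indexed_coset_act1 indexed_coset_actM).

Lemma coset_point_proof i x : L i :* x \in rcosets (L i) [set: gT].
Proof. by apply/rcosetsP; exists x; rewrite ?inE. Qed.

Definition coset_point (i : I) (x : gT) : coset_gset :=
  exist _ (i, L i :* x) (coset_point_proof i x).

Lemma coset_pointP (p : coset_gset) : exists i x, p = coset_point i x.
Proof.
case: p => -[i A] iA; have /rcosetsP[x _ defA] := iA.
by exists i, x; apply: val_inj; rewrite /= -defA.
Qed.

Lemma coset_point_mull i a x : a \in L i -> coset_point i (a * x) = coset_point i x.
Proof. by move=> La; apply: val_inj; rewrite /= rcosetM (rcoset_id La). Qed.

Lemma card_coset_gset : #|coset_gset| = (\sum_i #|[set: gT] : L i|)%N.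
Proof.
rewrite card_sig -sum1_card (eq_bigr (fun i => \sum_(A in rcosets (L i) [set: gT]) 1)%N).
  by rewrite pair_big_dep.
by move=> i _; rewrite sum1_card.
Qed.

End CosetGset.

Lemma coset_transversal (gT : finGroupType) (D B : {group gT}) s (c : 'I_s -> gT) :
    #|B : D| = s -> (forall j, c j \in B) ->
    (forall j j', D :* c j = D :* c j' -> j = j') ->
  forall y, y \in B -> exists j, D :* y = D :* c j.
Proof.
move=> oBD Bc injc y By.
have : D :* y \in [set D :* c j | j : 'I_s].
  have -> : [set D :* c j | j : 'I_s] = rcosets D B.
    apply/eqP; rewrite eqEcard (card_imset _ injc) card_ord [#|rcosets D B|]oBD leqnn andbT.
    by apply/subsetP=> _ /imsetP[j _ ->]; apply/rcosetsP; exists (c j).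
  by apply/rcosetsP; exists y.
by case/imsetP=> j _ ->; exists j.
Qed.

Section Relation.

Variables (k : fieldType) (gT : finGroupType) (r : nat).
Variables (D K H : {group gT}) (M : 'I_r -> {group gT}).

Definition rel_source (o : option 'I_r) : {group gT} := if o is Some _ then H else D.
Definition rel_target (o : option 'I_r) : {group gT} := if o is Some i then M i else K.

Local Notation X := (coset_gset rel_source).
Local Notation Y := (coset_gset rel_target).

Variable u : option 'I_r -> gT.

(* On maps G -> k that are left invariant (under D, resp. H), this is the map  *)
(* (f, (c_i)_i) |-> (tr_K f, (tr_(M i) (x |-> f (u_i x)) + c_i)_i), where tr_B *)
(* sums over the cosets of D in B.                                             *)
Definition rel_mx (p : X) (y : Y) : k :=
  (if (val p).1 is Some i then ((val y).1 == Some i) && ((val y).2 \subset (val p).2)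
   else (val p).2 \subset (u (val y).1 *: (val y).2)%g)%:R.

Lemma rel_mx_intertwining : intertwining rel_mx.
Proof.
move=> g [[[i|] A] /= iA] [[o B] /= oB]; rewrite /rel_mx /=; congr (_%:R).
  by rewrite rcosetS.
by rewrite mulgA rcosetS.
Qed.

Definition source_fun (f : {ffun X -> k}) (o : option 'I_r) (x : gT) : k :=
  f (coset_point rel_source o x).

(** Since [u o] normalises D, the cosets of D inside u B x are the D u b_j x, where b_j runs over a
    transversal of D in B. *)
Lemma rel_mx_sum_None (f : {ffun X -> k}) o x (s : nat) (b : 'I_s -> gT) :
    u o \in 'N(D) -> D \subset rel_target o -> #|rel_target o : D| = s ->
    (forall j, b j \in rel_target o) ->
    (forall j j', D :* b j = D :* b j' -> j = j') ->
  \sum_(p | (val p).1 == None) rel_mx p (coset_point rel_target o x) * f p =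
    \sum_(j < s) source_fun f None (u o * b j * x)%g.
Proof.
move=> nDu sDB oBD Bb injb.
have Du c : (D :* (u o * c) = u o *: (D :* c))%g.
  by rewrite rcosetM (norm_rlcoset nDu) mulgA.
pose h (j : 'I_s) := coset_point rel_source None (u o * b j * x)%g.
have injh : {in [set: 'I_s] &, injective h}.
  move=> j j' _ _ /(congr1 (fun p => (val p).2)) /=.
  rewrite !rcosetM => /rcoset_inj; rewrite -!rcosetM !Du => /lcoset_inj.
  exact: injb.
transitivity (\sum_(p in h @: [set: 'I_s]) f p); last first.
  by rewrite big_imset //; apply: eq_bigl => j; rewrite inE.
rewrite big_mkcond [RHS]big_mkcond; apply: eq_bigr => p _.
have [[i|] [z ->]] := coset_pointP p; rewrite /rel_mx /=.
  by case: imsetP => // -[j _ /(congr1 (fun p => (val p).1))].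
suff -> : (D :* z \subset u o *: (rel_target o :* x))%g
           = (coset_point rel_source None z \in h @: [set: 'I_s]).
  by case: ifP; rewrite ?mul1r ?mul0r.
apply/idP/imsetP => [sDz | [j _ /(congr1 (fun p => (val p).2)) /= ->]].
  have := subsetP sDz z (rcoset_refl _ _); rewrite mem_lcoset => /rcosetP[c Bc].
  move/(canRL (mulKVg _)); rewrite mulgA => ->.
  have [j Dcj] := coset_transversal oBD Bb injb Bc; exists j => //.
  by apply: val_inj; rewrite /= !(rcosetM _ _ x) !Du Dcj.
rewrite rcosetM Du -mulgA mulgS // mulSg //.
by rewrite mul_subG ?sub1set.
Qed.

(** Within the i-th copy of the cosets of H, only H x contains M_i x. *)
Lemma rel_mx_sum_Some (f : {ffun X -> k}) o x :
    (if o is Some i then M i \subset H else true) ->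
  \sum_(p | (val p).1 != None) rel_mx p (coset_point rel_target o x) * f p =
    (if o is Some i then source_fun f (Some i) x else 0).
Proof.
case: o => [i sMH | _]; last first.
  by rewrite big1 // => -[[[i|] A] /= iA] //= _; rewrite /rel_mx /= mul0r.
rewrite (bigD1 (coset_point rel_source (Some i) x)) //= [X in _ + X]big1.
  by rewrite /rel_mx /= eqxx mulSg // mul1r addr0.
move=> p; have [[i'|] [z ->]] := coset_pointP p; rewrite /rel_mx //= => neq.
case: (Some i =P Some i') neq => [[<-] neq | _ _]; last by rewrite /= mul0r.
case: (boolP (_ \subset _)) => [sMz | _]; last by rewrite /= mul0r.
case/eqP: neq; apply: val_inj; rewrite /=; congr (_, _); apply/esym/rcoset_eqP.
exact: (subsetP sMz) (rcoset_refl _ _).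
Qed.

End Relation.

Lemma prime_coset_order (gT : finGroupType) (D : {group gT}) (r : nat) (x : gT) :
  x \in 'N(D) -> prime r -> x \notin D -> (x ^+ r)%g \in D -> #[coset D x] = r.
Proof.
move=> Nx r_pr D'x Dxr.
have r_x : (#[coset D x] %| r)%N by rewrite order_dvdn -morphX //= coset_id.
have /primeP[_ /(_ _ r_x)/orP[|/eqP//]] := r_pr.
by rewrite order_eq1 => /eqP/coset_idr => /(_ Nx); rewrite (negPf D'x).
Qed.

Lemma index_expg_mem (gT : finGroupType) (D K : {group gT}) (q : nat) (x : gT) :
  D <| K -> #|K : D| = q -> x \in K -> (x ^+ q)%g \in D.
Proof.
move=> nDK oKD Kx; have Nx := subsetP (normal_norm nDK) x Kx.
apply: coset_idr; rewrite ?groupX // morphX //; apply/eqP.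
by rewrite -order_dvdn -oKD -card_quotient ?normal_norm // order_dvdG ?mem_quotient.
Qed.

Lemma prime_index_order (gT : finGroupType) (D K : {group gT}) (q : nat) (n : gT) :
  D <| K -> prime q -> #|K : D| = q -> n \in K -> n \notin D -> #[coset D n] = q.
Proof.
move=> nDK q_pr oKD Kn D'n; apply: prime_coset_order => //.
  exact: subsetP (normal_norm nDK) n Kn.
exact: index_expg_mem nDK oKD Kn.
Qed.

Lemma rcoset_expg_inj (gT : finGroupType) (D : {group gT}) (n : gT) a b :
  n \in 'N(D) -> D :* (n ^+ a) = D :* (n ^+ b) -> a = b %[mod #[coset D n]].
Proof.
move=> Nn /rcoset_eqP/(rcoset_kercosetP (groupX a Nn) (groupX b Nn)).
by rewrite !morphX // => /eqP; rewrite eq_expg_mod_order => /eqP.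
Qed.

Section LeftTranslation.

Variables (k : fieldType) (gT : finGroupType) (n : gT).

Definition left_translate (f : {ffun gT -> k}) : {ffun gT -> k} :=
  [ffun x => f (n * x)%g].

Lemma left_translate_zmod_morphism : zmod_morphism left_translate.
Proof. by move=> f g; apply/ffunP=> x; rewrite !ffunE. Qed.

HB.instance Definition _ := GRing.isZmodMorphism.Build {ffun gT -> k} {ffun gT -> k}
  left_translate left_translate_zmod_morphism.

Lemma iter_left_translateE a f x : iter a left_translate f x = f (n ^+ a * x)%g.
Proof.
elim: a x => [|a IHa] x; first by rewrite mul1g.
by rewrite iterS ffunE IHa mulgA -expgSr.
Qed.

End LeftTranslation.

Definition has_relation (k : fieldType) (gT : finGroupType) : Prop :=
  exists X Y : gset gT, ~ gset_iso X Y /\ linearly_equivalent k X Y.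

(** * The basic relation *)

(* The relation [G/D] + r [G/H] ~ [G/K] + sum_i [G/M i], where H = K<m>, K/D   *)
(* is generated by n, and m^j n^(i t_j), j < r, represent u_i (D \ M i).       *)
Section CosetRelation.

Variables (k : fieldType) (gT : finGroupType) (q r : nat).
Variables (D K H : {group gT}) (M : 'I_r -> {group gT}).
Variables (n m : gT) (t : 'I_r -> nat) (u : 'I_r -> gT).

Hypotheses (q_prime : prime q) (q_neq0 : q%:R != 0 :> k) (r_gt0 : (0 < r)%N).
Hypotheses (nDH : D <| H) (nKH : K <| H) (sDK : D \subset K).
Hypotheses (sDM : forall i, D \subset M i) (sMH : forall i, M i \subset H).
Hypotheses (oKD : #|K : D| = q) (oMD : forall i, #|M i : D| = r).
Hypothesis oHD : #|H : D| = (q * r)%N.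
Hypotheses (Kn : n \in K) (D'n : n \notin D) (Hm : m \in H).
Hypothesis Hu : forall i, u i \in H.
Hypothesis M_transversal : forall i j : 'I_r, ((u i)^-1 * m ^+ j * n ^+ (i * t j))%g \in M i.
Hypothesis m_inj : forall j j' : 'I_r, (m ^+ j)%g \in K :* (m ^+ j') -> j = j'.
Hypothesis t_inj : forall j j', t j = t j' %[mod q] -> j = j'.

Let sKH : K \subset H. Proof. exact: normal_sub. Qed.
Let sDH : D \subset H. Proof. exact: normal_sub. Qed.
Let nDKH : H \subset 'N(D). Proof. exact: normal_norm. Qed.
Let nKH' : H \subset 'N(K). Proof. exact: normal_norm. Qed.
Let q_gt0 : (0 < q)%N. Proof. exact: prime_gt0. Qed.

(** In units of |G : H|, the two sides count qr + r and r + rq. *)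
Lemma relation_card :
  #|coset_gset (rel_source (r := r) D H)| = #|coset_gset (rel_target K M)|.
Proof.
have sum_option (F : option 'I_r -> nat) : (\sum_o F o = F None + \sum_i F (Some i))%N.
  rewrite (bigD1 None) //=; congr addn.
  by rewrite (reindex_omap Some id) => [|[i|] //]; apply: eq_bigl => i; rewrite eqxx.
rewrite !card_coset_gset !sum_option /=.
have lag (A B : {group gT}) : A \subset B -> B \subset H ->
    (#|[set: gT] : B| * #|B : A| = #|[set: gT] : A|)%N.
  by move=> sAB sBH; apply: Lagrange_index; rewrite ?subsetT.
have oD : #|[set: gT] : D| = (#|[set: gT] : H| * (q * r))%N by rewrite -oHD lag.
have oK : #|[set: gT] : K| = (#|[set: gT] : H| * r)%N.
  apply/eqP; rewrite -(eqn_pmul2r q_gt0) -{1}oKD lag // oD.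
  by rewrite -mulnA [(r * q)%N]mulnC.
have oM i : #|[set: gT] : M i| = (#|[set: gT] : H| * q)%N.
  by apply/eqP; rewrite -(eqn_pmul2r r_gt0) -{1}(oMD i) lag // oD mulnA.
under [in RHS]eq_bigr => i _ do rewrite oM.
rewrite !sum_nat_const !card_ord oD oK addnC [(q * r)%N]mulnC mulnC; congr addn.
by rewrite mulnCA.
Qed.

(** Let (F, c) be in the kernel. The K-component says that F has trace zero over K/D. Averaging the
    i-th component over powers of n then leaves q c_i = 0, so c_i = 0. What remains is a Vandermonde
    system for the functions x |-> F(m^j x), with nodes the translations by n^(t_j). *)
Lemma relation_linearly_equivalent :
  linearly_equivalent k (coset_gset (rel_source (r := r) D H)) (coset_gset (rel_target K M)).
Proof.
pose w (o : option 'I_r) := if o is Some i then u i else 1%g.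
apply: (linearly_equivalent_of_mx (N := rel_mx k w)).
- exact: rel_mx_intertwining.
- exact: relation_card.
move=> f fN0; pose F := source_fun f None; pose c i := source_fun f (Some i).
have F_D d x : d \in D -> F (d * x)%g = F x.
  by move=> Dd; rewrite /F /source_fun coset_point_mull.
have trF (b : 'I_q -> gT) x : (forall a, b a \in K) ->
    (forall a a', D :* b a = D :* b a' -> a = a') -> \sum_(a < q) F (b a * x)%g = 0.
  move=> Kb injb; have := fN0 (coset_point (rel_target K M) None x).
  rewrite (bigID (fun p => (val p).1 == None)) /= rel_mx_sum_Some // addr0.
  rewrite (rel_mx_sum_None (M := M) (u := w) (o := None) f x _ sDK oKD Kb injb) ?group1 //= => e.
  by rewrite -[RHS]e; apply: eq_bigr => a _; rewrite mul1g.
have eqF (i : 'I_r) x : \sum_(j < r) F (m ^+ j * n ^+ (i * t j) * x)%g + c i x = 0.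
  have := fN0 (coset_point (rel_target K M) (Some i) x).
  rewrite (bigID (fun p => (val p).1 == None)) /= rel_mx_sum_Some //.
  rewrite (rel_mx_sum_None (K := K) (u := w) (o := Some i) f x _ (sDM i) (oMD i)
    (M_transversal i)) ?(subsetP nDKH) //=.
    move=> e; rewrite -[RHS]e; congr (_ + _).
    by apply: eq_bigr => a _; rewrite -!mulgA mulKVg.
  (* Modulo K the powers of n disappear, and conjugation by u_i reduces distinctness to that of the
     powers of m. *)
  move=> j j' /rcoset_eqP; rewrite mem_rcoset => /(subsetP sDK) Kjj'.
  apply: m_inj; rewrite mem_rcoset.
  pose z := (n ^+ (i * t j) * (n ^+ (i * t j'))^-1)%g.
  have: ((m ^+ j * z * (m ^+ j')^-1) ^ u i)%g \in K.
    by move: Kjj'; rewrite !invMg invgK conjgE !mulgA.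
  rewrite memJ_norm ?(subsetP nKH') //.
  have -> : (m ^+ j * z * (m ^+ j')^-1 = z ^ (m ^- j) * (m ^+ j * m ^- j'))%g.
    by rewrite conjgE invgK -!mulgA mulKg.
  rewrite groupMl // memJ_norm ?(groupM, groupV, groupX) //.
  exact: (subsetP nKH').
have nDK : D <| K by rewrite /normal sDK (subset_trans sKH).
have Nm j : (m ^+ j)%g \in H by apply: groupX.
(* Moving m^j to the right replaces n by a conjugate, which again generates K modulo D. *)
have trace_m j x : \sum_(a < q) F (m ^+ j * n ^+ a * x)%g = 0.
  pose n' := (n ^ (m ^- j))%g.
  have Nmj : (m ^- j)%g \in H by rewrite groupV.
  have Kn' : n' \in K by rewrite memJ_norm // (subsetP nKH').
  have D'n' : n' \notin D by rewrite memJ_norm // (subsetP nDKH).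
  rewrite -[RHS](trF (fun a => n' ^+ a)%g (m ^+ j * x)%g).
  - apply: eq_bigr => a _; congr F.
    by rewrite /n' -conjXg conjgE invgK !mulgA mulgKV.
  - by move=> a; rewrite groupX.
  move=> a a' /rcoset_expg_inj; rewrite (prime_index_order nDK q_prime oKD Kn' D'n').
  rewrite !modn_small // => eq_aa'; apply/val_inj/eq_aa'.
  by rewrite (subsetP nDKH) ?(subsetP sKH).
have c0 i x : c i x = 0.
  have cn a : c i (n ^+ a * x)%g = c i x.
    by rewrite /c /source_fun coset_point_mull //= groupX // (subsetP sKH).
  have : \sum_(a < q) (\sum_(j < r) F (m ^+ j * n ^+ (i * t j) * (n ^+ a * x))%g
                        + c i (n ^+ a * x)%g) = 0.
    by apply: big1 => a _; apply: eqF.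
  rewrite big_split exchange_big /= big1 => [|j _]; last first.
    rewrite -[RHS](trace_m j (n ^+ (i * t j) * x)%g); apply: eq_bigr => a _.
    by congr F; rewrite -!mulgA; congr (_ * _)%g; rewrite !mulgA -!expgD addnC.
  rewrite add0r (eq_bigr (fun=> c i x)) => [|a _]; last exact: cn.
  by rewrite sumr_const card_ord -mulr_natl => /eqP; rewrite mulf_eq0 (negPf q_neq0) => /eqP.
pose g (j : 'I_r) : {ffun gT -> k} := [ffun x => F (m ^+ j * x)%g].
pose T := left_translate (k := k) n.
have gE j a x : iter a T (g j) x = F (m ^+ j * n ^+ a * x)%g.
  by rewrite iter_left_translateE ffunE mulgA.
pose s := [seq (t j, g j) | j <- enum 'I_r].
have torsion_free (v : {ffun gT -> k}) : v *+ q = 0 -> v = 0.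
  move/ffunP=> qv0; apply/ffunP=> x; have := qv0 x.
  by rewrite ffunMnE !ffunE -mulr_natl => /eqP; rewrite mulf_eq0 (negPf q_neq0) => /eqP.
have g0 j : g j = 0.
  have s_j : (t j, g j) \in s by apply: (map_f (fun j => (t j, g j))); rewrite mem_enum.
  apply: (vandermonde_injective (T := T) q_prime torsion_free) s_j.
  - rewrite -map_comp map_inj_in_uniq ?enum_uniq // => j1 j2 _ _ /=; exact: t_inj.
  - move=> _ /mapP[j1 _ ->] /=; split.
      apply/ffunP=> x; rewrite gE ffunE (conjgCV (m ^+ j1)) -mulgA F_D //.
      by rewrite memJ_norm ?(index_expg_mem nDK oKD Kn) // (subsetP nDKH) // groupV.
    apply/ffunP=> x; rewrite sum_ffunE [RHS]ffunE -[RHS](trace_m j1 x).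
    by apply: eq_bigr => a _; rewrite gE.
  rewrite size_map size_enum_ord => i lt_i_r; rewrite big_map big_enum /=.
  apply/ffunP=> x; rewrite sum_ffunE [RHS]ffunE -[RHS](eqF (Ordinal lt_i_r) x) c0 addr0.
  by apply: eq_bigr => j1 _; rewrite gE.
apply/ffunP=> p; rewrite [RHS]ffunE; have [[i|] [x ->]] := coset_pointP p.
  exact: c0.
by have /ffunP/(_ x) := g0 (Ordinal r_gt0); rewrite !ffunE mul1g.
Qed.

(** H fixes a point of G/H, so an isomorphism would place a conjugate of H inside K or some M_i,
    whose indices in H are r and q. *)
Lemma relation_not_iso :
  (1 < r)%N -> ~ gset_iso (coset_gset (rel_source (r := r) D H)) (coset_gset (rel_target K M)).
Proof.
move=> r_gt1 [phi _ phi_act].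
pose p := coset_point (rel_source (r := r) D H) (Some (Ordinal r_gt0)) 1%g.
have [o [x def_p]] := coset_pointP (phi p).
have fixp h : h \in H -> (x * h * x^-1)%g \in rel_target K M o.
  move=> Hh; rewrite -mem_rcoset; apply/rcoset_eqP.
  have: phi (gact _ p h) = gact _ (phi p) h by apply: phi_act.
  have -> : gact _ p h = p by apply: val_inj; rewrite /= mulg1 rcoset_id.
  rewrite def_p => /(congr1 (fun y => (val y).2)) /=.
  by rewrite rcosetM => <-.
have sHB : H :^ x^-1 \subset rel_target K M o.
  by apply/subsetP=> _ /imsetP[h Hh ->]; rewrite conjgE invgK mulgA fixp.
have sBH : rel_target K M o \subset H by case: (o) => [i|] /=; rewrite ?sMH.
have sDB : D \subset rel_target K M o by case: (o) => [i|] /=; rewrite ?sDM.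
have eBH : rel_target K M o :=: H.
  by apply/eqP; rewrite eqEcard sBH -(cardJg H x^-1) subset_leq_card.
have := oHD; rewrite -eBH; case: (o) => [i|] /=; rewrite ?oMD ?oKD => /eqP.
  by rewrite -[X in X == _]mul1n eqn_pmul2r // => /eqP q1; have := prime_gt1 q_prime; rewrite -q1.
by rewrite -[X in X == _]muln1 eqn_pmul2l // => /eqP r1; have := r_gt1; rewrite -r1.
Qed.

Lemma coset_relation : (1 < r)%N -> has_relation k gT.
Proof.
move=> r_gt1; exists (coset_gset (rel_source (r := r) D H)), (coset_gset (rel_target K M)).
split; [exact: relation_not_iso | exact: relation_linearly_equivalent].
Qed.

End CosetRelation.

(* For distinct maximal subgroups K1 = D<n> and K2 = D<x> of S, where S / D is *)
(* elementary abelian of rank 2, take M i = D<x n^i>.                          *)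
Lemma noncyclic_pgroup_relation (k : fieldType) (gT : finGroupType) (q : nat)
    (S : {group gT}) :
  prime q -> q%:R != 0 :> k -> q.-group S -> ~~ cyclic S -> has_relation k gT.
Proof.
move=> q_pr q_neq0 qS ncycS.
have ntS : S :!=: 1%g by apply: contraNneq ncycS => ->; apply: cyclic1.
have [K1 maxK1 _] : exists2 K1 : {group gT}, maximal K1 S & 1%G \subset K1.
  by have [S1 | //] := maximal_exists (sub1G S); rewrite -S1 eqxx in ntS.
have nK1S := p_maximal_normal qS maxK1; have oSK1 := p_maximal_index qS maxK1.
have [_ [x Sx K1'x]] := properP (maxgroupp maxK1).
(* As S is not cyclic, <x> is proper; x lies outside K1, so K2 differs from K1. *)
have [K2 maxK2 K2x] : exists2 K2 : {group gT}, maximal K2 S & <[x]> \subset K2.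
  have sxS : <[x]> \subset S by rewrite cycle_subG.
  have [defS | //] := maximal_exists sxS.
  by case/negP: ncycS; rewrite -defS cycle_cyclic.
rewrite cycle_subG in K2x.
have nK2S := p_maximal_normal qS maxK2; have oSK2 := p_maximal_index qS maxK2.
pose D := (K1 :&: K2)%G.
have sDK1 : D \subset K1 := subsetIl K1 K2.
have sDK2 : D \subset K2 := subsetIr K1 K2.
have sK1S := normal_sub nK1S; have sK2S := normal_sub nK2S.
have nDS : D <| S by rewrite normalI.
have K12 : (K1 * K2)%g = S.
  apply: mulg_normal_maximal => //; apply/subsetPn; by exists x.
have oK1D : #|K1 : D| = q.
  apply/eqP; rewrite -(eqn_pmul2r (cardG_gt0 D)) -(eqn_pmul2r (cardG_gt0 K2)).
  by rewrite [(#|_ : _| * _)%N]mulnC Lagrange // mul_cardG K12 -oSK2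
    -(Lagrange sK2S) -mulnA mulnC.
have oSD : #|S : D| = (q * q)%N by rewrite -(Lagrange_index sK1S sDK1) oSK1 oK1D.
have [n K1n D'n] : exists2 n, n \in K1 & n \notin D.
  apply/subsetPn; apply/negP=> sK1D; have := prime_gt1 q_pr.
  by move: sK1D; rewrite -indexg_eq1 oK1D => /eqP->.
have K2'n : n \notin K2 by apply: contra D'n => K2n; rewrite inE K1n.
have abSD : abelian (S / D)%g.
  apply: sub_der1_abelian; rewrite subsetI !der1_min ?normal_norm //;
    by apply/cyclic_abelian/prime_cyclic; rewrite card_quotient ?normal_norm ?oSK1 ?oSK2.
have NS y : y \in S -> y \in 'N(D) by apply: subsetP; rewrite normal_norm.
have Sn : n \in S := subsetP sK1S n K1n.
pose y (i : nat) := (x * n ^+ i)%g.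
have Sy i : y i \in S by rewrite groupM ?groupX.
have K1'y i : y i \notin K1 by rewrite groupMr ?groupX.
have yq i : (y i ^+ q)%g \in D.
  by rewrite inE !(index_expg_mem (K := S)) ?oSK1 ?oSK2.
have oy i : #[coset D (y i)] = q.
  apply: prime_coset_order => //; first exact: NS.
  exact: contra (subsetP sDK1 _) (K1'y i).
pose M (i : 'I_q) := (D <*> <[y i]>)%G.
apply: (coset_relation (q := q) (r := q) (D := D) (K := K1) (H := S) (M := M)
  (n := n) (m := x) (t := fun j => j) (u := fun=> 1%g)) => //.
- exact: prime_gt0.
- by move=> i; apply: joing_subl.
- by move=> i; rewrite join_subG (normal_sub nDS) cycle_subG Sy.
- move=> i; rewrite -card_quotient; last first.
    by rewrite join_subG normG cycle_subG NS ?Sy.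
  by rewrite quotientYidl ?cycle_subG ?NS ?Sy // quotient_cycle ?NS ?Sy // -orderE.
(* S/D is abelian, so (x n^i)^j and x^j n^(ij) agree modulo D. *)
- move=> i j; rewrite invg1 mul1g.
  suff: (x ^+ j * n ^+ (i * j))%g \in D :* (y i ^+ j).
    apply: subsetP; rewrite mul_subG ?joing_subl // sub1set.
    by rewrite groupX // (subsetP (joing_subr D _)) ?cycle_id.
  apply/rcoset_kercosetP; rewrite ?groupM ?groupX ?NS //.
  rewrite morphX ?NS // !morphM ?groupX ?NS // expgMn.
    by rewrite !morphX ?NS // expgM.
  by apply: (centsP abSD); rewrite mem_quotient ?groupX.
- move=> j j' /rcoset_eqP/rcoset_expg_inj; rewrite (prime_index_order nK1S q_pr) //.
  rewrite !modn_small // => eq_jj'; apply/val_inj/eq_jj'.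
  exact: subsetP (normal_norm nK1S) x Sx.
- by move=> j j'; rewrite !modn_small // => /val_inj.
- exact: prime_gt1.
Qed.

(** Take d > 0 least with g^d in C, a prime r dividing d, and m = g^(d/r). *)
Lemma noncentral_prime_power (gT : finGroupType) (C : {group gT}) (g : gT) :
  g \notin C -> exists2 r, prime r & exists2 m, m \in <[g]> & (m \notin C) && (m ^+ r \in C)%g.
Proof.
move=> C'g; have ex_d : exists d, (0 < d)%N && (g ^+ d \in C)%g.
  by exists #[g]; rewrite order_gt0 expg_order group1.
case: (ex_minnP ex_d) => d /andP[d_gt0 Cgd] min_d.
have d_gt1 : (1 < d)%N by case: d d_gt0 Cgd {min_d} => [|[|]] //; rewrite expg1 (negPf C'g).
have r_pr := pdiv_prime d_gt1; have r_d := pdiv_dvd d.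
exists (pdiv d) => //; exists (g ^+ (d %/ pdiv d))%g; first exact: mem_cycle.
rewrite -expgM divnK // Cgd andbT; apply/negP=> Cg.
have := min_d (d %/ pdiv d)%N; rewrite Cg divn_gt0 ?pdiv_gt0 // pdiv_leq // => /(_ isT).
by rewrite leqNgt ltn_Pdiv // prime_gt1.
Qed.

(* With m a power of g acting on N with prime order r, take D = <m^r>,         *)
(* K = N D, H = N<m> and all M i = <m>.                                        *)
Lemma nontrivial_action_relation (k : fieldType) (gT : finGroupType)
    (N : {group gT}) (g : gT) :
    prime #|N| -> #|N|%:R != 0 :> k -> g \in 'N(N) -> g \notin 'C(N) ->
  has_relation k gT.
Proof.
move=> q_pr q_neq0 nNg C'g; set q := #|N| in q_pr q_neq0.
have [r r_pr [m /cycleP[e def_m] /andP[C'm Cmr]]] := noncentral_prime_power C'g.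
have nNm : m \in 'N(N) by rewrite def_m groupX.
have [n defN] := cyclicP (prime_cyclic q_pr).
have Nn : n \in N by rewrite defN cycle_id.
have on : #[n] = q by rewrite orderE -defN.
have cNE x : (x \in 'C(N)) = (n ^ x == n)%g.
  rewrite defN cent_cycle; apply/cent1P/eqP=> e_nx; first by rewrite conjgE -e_nx mulKg.
  by rewrite /commute (conjgC n x) e_nx.
pose R := <[m]>%G; pose D := <[(m ^+ r)%g]>%G.
pose K := (N <*> D)%G; pose H := (N <*> R)%G.
have sDR : D \subset R by apply: cycleX.
have nNR : R \subset 'N(N) by rewrite cycle_subG.
have cND : D \subset 'C(N) by rewrite cycle_subG.
have abN : abelian N by rewrite defN cycle_abelian.
have cNK : K \subset 'C(N) by rewrite join_subG cND andbT.
have tiNR : N :&: R = 1%g.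
  apply: prime_TIg => //; apply/negP=> sNR; case/negP: C'm.
  rewrite -cycle_subG; apply: sub_abelian_cent sNR => //; exact: cycle_abelian.
have nDR : R \subset 'N(D) by rewrite cents_norm // (sub_abelian_cent (cycle_abelian m)).
have nDN : N \subset 'N(D) by rewrite cents_norm // centsC.
have Hm : m \in H by rewrite (subsetP (joing_subr N R)) ?cycle_id.
have sDH : D \subset H by rewrite (subset_trans sDR) // joing_subr.
have nDH : D <| H by rewrite /normal sDH join_subG nDN.
have sKH : K \subset H by rewrite join_subG joing_subl.
have nKH : K <| H.
  rewrite /normal sKH join_subG (subset_trans (joing_subl N D)) ?normG //.
  by rewrite normsY.
have oK : #|K| = (q * #|D|)%N.
  by rewrite /= norm_joinEr ?TI_cardMg ?(subset_trans sDR) //; apply/trivgP;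
    rewrite -tiNR setIS.
have oH : #|H| = (q * #|R|)%N by rewrite /= norm_joinEr ?TI_cardMg.
have D'm : m \notin D by apply: contra C'm; apply: (subsetP cND).
have K'm : m \notin K by apply: contra C'm; apply: (subsetP cNK).
have NDm : m \in 'N(D) by rewrite (subsetP nDR) ?cycle_id.
have NKm : m \in 'N(K) by rewrite (subsetP (normal_norm nKH)).
have NCm : m \in 'N('C(N)) by rewrite (subsetP (norms_cent (subxx 'N(N)))).
have Dmr : (m ^+ r)%g \in D by rewrite cycle_id.
have oRD : #|R : D| = r.
  rewrite -card_quotient // quotient_cycle // -orderE.
  exact: prime_coset_order.
have eq_mod_r (L : {group gT}) (j j' : 'I_r) : m \in 'N(L) -> m \notin L -> (m ^+ r)%g \in L ->
    (m ^+ j)%g \in L :* m ^+ j' -> j = j'.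
  move=> NLm L'm Lmr /rcoset_eqP/rcoset_expg_inj; rewrite (prime_coset_order NLm r_pr) //.
  by rewrite !modn_small // => eq_jj'; apply/val_inj/eq_jj'.
have conj_n (j : 'I_r) : exists e, (n ^ (m ^+ j) = n ^+ e)%g.
  by apply/cycleP; rewrite -defN memJ_norm // groupX.
(* Conjugation by m^j raises n to the power t_j, so n^(-i) m^j n^(i t_j) = m^j lies in <m>. *)
have [t def_t] := fin_all_exists conj_n.
apply: (coset_relation (q := q) (r := r) (D := D) (K := K) (H := H) (M := fun=> R)
  (n := n) (m := m) (t := t) (u := fun i : 'I_r => (n ^+ i)%g)) => //.
- exact: prime_gt0.
- exact: joing_subr.
- by move=> _; apply: joing_subr.
- by rewrite -divgS ?joing_subr // oK mulnK.
- by rewrite -divgS // oH -(Lagrange sDR) oRD mulnCA mulKn.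
- by rewrite (subsetP (joing_subl N D)).
- apply/negP=> Dn; have : n \in N :&: R by rewrite inE Nn (subsetP sDR).
  by rewrite tiNR => /set1P n1; have := prime_gt1 q_pr; rewrite -on n1 order1.
- by move=> i; rewrite groupX // (subsetP (joing_subl N R)).
- move=> i j; rewrite mulnC expgM -def_t -conjXg conjgE -!mulgA.
  by rewrite mulKVg mulKg mem_cycle.
- by move=> j j'; apply: eq_mod_r => //; apply: (subsetP (joing_subr N D)).
(* If t_j = t_j' modulo q, then m^j m^(-j') centralises N, while m has order r modulo the
   centraliser. *)
- move=> j j' /eqP; rewrite -on -eq_expg_mod_order -!def_t => /eqP eq_n.
  apply: (eq_mod_r 'C(N)%G) => //; rewrite mem_rcoset cNE.
  by rewrite conjgM eq_n -conjgM mulgV conjg1.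
- exact: prime_gt1.
Qed.

(** * Groups that are not cyclic mod p *)

(** Both S and S^x are Sylow in the centraliser of g^x, hence conjugate there by some c. Then xc
    normalises S, so it centralises g, and g = g^(xc) = g^x. *)
Lemma central_Sylow_fusion (gT : finGroupType) (q : nat) (G S : {group gT}) g x :
    q.-Sylow(G) S -> abelian S -> 'N_G(S) \subset 'C(S) ->
  g \in S -> x \in G -> (g ^ x)%g \in S -> (g ^ x = g)%g.
Proof.
move=> sylS abS cNS Sg Gx Sgx; have sSG := pHall_sub sylS.
pose C := ('C_G[g ^ x])%G.
have sylC (T : {group gT}) : q.-Sylow(G) T -> abelian T -> (g ^ x)%g \in T -> q.-Sylow(C) T.
  move=> sylT abT Tgx; have sTG := pHall_sub sylT.
  apply: pHall_subl sylT; last exact: subsetIl.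
  by rewrite subsetI sTG sub_cent1 (subsetP abT).
have sylCSx : q.-Sylow(C) (S :^ x)%G.
  by apply: sylC; rewrite /= ?pHallJ ?abelianJ ?memJ_conjg.
have [c /setIP[Gc /cent1P cgc] /= defS] := Sylow_trans sylCSx (sylC S sylS abS Sgx).
have Nxc : (x * c)%g \in 'N_G(S).
  by rewrite inE groupM //; apply/normP; rewrite conjsgM -defS.
have com := centP (subsetP cNS _ Nxc) g Sg.
have <- : (g ^ (x * c) = g ^ x)%g by rewrite conjgM conjgE -cgc mulKg.
by rewrite conjgE -com mulKg.
Qed.

(* On S, the transfer of G into S is g |-> g ^+ #|G : S|.                      *)
Lemma Burnside_transfer (gT : finGroupType) (q : nat) (G S : {group gT}) :
    q.-Sylow(G) S -> abelian S -> 'N_G(S) \subset 'C(S) ->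
  S :&: G^`(1)%g = 1%g.
Proof.
move=> sylS abS cNS; have sSG := pHall_sub sylS.
have abA : abelian (idm S @* S) by rewrite im_idm.
apply/trivgP/subsetP=> g /setIP[Sg G'g]; apply/set1P.
have Gg := subsetP sSG g Sg.
have trX := transversalP (rcosets_cycle_partition sSG Gg).
pose V := transfer_morphism G abA.
have Vg1 : V g = 1%g.
  have: V g \in (V @* G^`(1)%g)%g by apply: mem_morphim.
  have /derG1P V'1 : abelian (V @* G)%g by apply: FinRing.zmod_abelian.
  by rewrite morphim_der // V'1 => /set1P.
(* Each cycle of g on the cosets of S contributes a conjugate of g^n lying in S, which by fusion is
   g^n itself. *)
have fusion x : x \in G -> let n := #|<[g]> : S :* x| in
    ((g ^+ n) ^ x^-1 = g ^+ n)%g /\ ((g ^+ n) ^ x^-1)%g \in S.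
  move=> Gx n; have Sgn : ((g ^+ n) ^ x^-1)%g \in S.
    have := mulg_exp_card_rcosets S g x.
    by rewrite mem_rcoset conjgE invgK mulgA.
  by split=> //; apply: central_Sylow_fusion sylS abS cNS _ _ _; rewrite ?groupX ?groupV.
have sXG := subsetP (transversal_sub trX).
have Vg : FiniteModule.fmval (V g) = (g ^+ #|G : S|)%g.
  rewrite /V /= (transfer_cycle_expansion sSG abA Gg trX) FiniteModule.fmval_sum.
  rewrite -(sum_index_rcosets_cycle sSG Gg trX) (big_morph _ (expgD g) (expg0 g)).
  apply: eq_bigr => x Xx; have [fix_gn Sgn] := fusion x (sXG x Xx).
  by rewrite /restrm /= FiniteModule.fmodK /= ?im_idm /idm ?fix_gn // -fix_gn.
have gS1 : (g ^+ #|G : S| = 1)%g by rewrite -Vg Vg1.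
have /andP[_ coSGS] := pHall_Hall sylS.
by rewrite -(expgK coSGS Sg) gS1 expg1n.
Qed.

Section Criterion.

Variables (gT : finGroupType) (G : {group gT}) (p : nat).

Hypothesis cyclic_pgroups : forall q (S : {group gT}),
  prime q -> q != p -> S \subset G -> q.-group S -> cyclic S.
Hypothesis trivial_actions : forall (N : {group gT}) g,
  prime #|N| -> #|N| != p -> N \subset G -> g \in G -> g \in 'N(N) -> g \in 'C(N).

(** If [S, y] were nontrivial, it would contain a subgroup of order q. That subgroup is
    characteristic in the cyclic S, so y centralises it, whereas [S, y] meets the centraliser of y
    trivially. *)
Lemma coprime_action_trivial q (S : {group gT}) y :
    prime q -> q != p -> S \subset G -> q.-group S -> y \in G -> y \in 'N(S) ->
  coprime #|S| #[y] -> y \in 'C(S).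
Proof.
move=> q_pr q'p sSG qS Gy nSy co_Sy; have cycS := cyclic_pgroups q_pr q'p sSG qS.
have nSY : <[y]> \subset 'N(S) by rewrite cycle_subG.
have sRS : [~: S, <[y]>] \subset S by rewrite commg_subl.
have TI := coprime_abel_cent_TI nSY co_Sy (cyclic_abelian cycS).
rewrite -cycle_subG centsC; apply/commG1P/eqP/idPn => ntR.
have [_ q_R _] := pgroup_pdiv (pgroupS sRS qS) ntR.
have [z Rz oz] := Cauchy q_pr q_R.
have sZS : <[z]> \subset S by rewrite cycle_subG (subsetP sRS).
have chZ : <[z]> \char S by rewrite sub_cyclic_char.
have cZy : y \in 'C(<[z]>).
  apply: trivial_actions; rewrite -?orderE ?oz ?(subset_trans sZS) //.
  exact: subsetP (char_norms chZ) y nSy.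
have : z \in 'C_[~: S, <[y]>](<[y]>).
  by rewrite inE Rz cent_cycle cent1C -cent_cycle.
by rewrite TI => /set1P z1; have := prime_gt1 q_pr; rewrite -oz z1 order1.
Qed.

(** The q-part of an element normalising S lies in the abelian S; its q'-part acts coprimely. *)
Lemma Sylow_central_in_normaliser q (S : {group gT}) :
  prime q -> q != p -> q.-Sylow(G) S -> 'N_G(S) \subset 'C(S).
Proof.
move=> q_pr q'p sylS; have [sSG qS _] := and3P sylS.
have abS := cyclic_abelian (cyclic_pgroups q_pr q'p sSG qS).
apply/subsetP=> x /setIP[Gx nSx]; rewrite -(consttC q x) groupM //.
  apply: (subsetP abS); have nSS : S <| 'N_G(S) by rewrite normalSG.
  have sylNS : q.-Sylow('N_G(S)) S by rewrite (pHall_subl _ (subsetIl G _) sylS) ?normal_sub.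
  by rewrite (mem_normal_Hall sylNS nSS) ?p_elt_constt // groupX // inE Gx.
apply: (coprime_action_trivial q_pr q'p) => //; rewrite ?groupX //.
by apply: (pnat_coprime qS); apply: p_elt_constt.
Qed.

(** For a prime q other than p, a Sylow q-subgroup of G meets G' in a Sylow subgroup of G', which is
    trivial by transfer. *)
Lemma derived_subgroup_pgroup : p.-group G^`(1).
Proof.
apply/pgroupP=> q q_pr q_G'; rewrite inE; apply/idPn=> q'p.
have [S sylS] := Sylow_exists q G; have [sSG qS _] := and3P sylS.
have abS := cyclic_abelian (cyclic_pgroups q_pr q'p sSG qS).
have TI := Burnside_transfer sylS abS (Sylow_central_in_normaliser q_pr q'p sylS).
have /card_Hall/esym/eqP := Sylow_setI_normal (der_normal 1 G) sylS.
rewrite /= setIC TI cards1 p_part_eq1 mem_primes q_pr cardG_gt0 /=.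
by rewrite q_G'.
Qed.

(** A Sylow p-subgroup P contains G', so G/P is abelian. Its Sylow subgroups are images of those of
    G, cyclic for q <> p and trivial for q = p. *)
Lemma cyclic_mod_criterion : cyclic_mod p G.
Proof.
have [P sylP] := Sylow_exists p G; have [sPG pP _] := and3P sylP.
have sG'P : G^`(1)%g \subset P.
  by apply: normal_sub_max_pgroup (Hall_max sylP) derived_subgroup_pgroup (der_normal 1 G).
have nPG : P <| G := sub_der1_normal sG'P sPG.
have cycGP : cyclic (G / P)%g.
  apply: nil_Zgroup_cyclic; last exact/abelian_nil/sub_der1_abelian.
  apply/forall_inP=> V /SylowP[q q_pr sylV].
  have [S sylS] := Sylow_exists q G; have [sSG qS _] := and3P sylS.
  have nPS := subset_trans sSG (normal_norm nPG).
  have [x _ ->] := Sylow_trans (quotient_pHall nPS sylS) sylV.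
  rewrite cyclicJ; have [qp | q'p] := eqVneq q p; last first.
    by apply: quotient_cyclic; apply: cyclic_pgroups q'p sSG qS.
  have SP1 : (S / P = 1)%g.
    by apply/trivgP; rewrite quotient_sub1 // (sub_normal_Hall sylP nPG sSG) -qp.
  by rewrite /= SP1 cyclic1.
rewrite /cyclic_mod; case: eqVneq => [p0 | _]; last by apply/existsP; exists P; apply/and3P.
(* A nontrivial p-group would make p = 0 prime. *)
have P1 : P :=: 1%g.
  by apply/eqP/idPn=> ntP; have [] := pgroup_pdiv pP ntP; rewrite p0.
by rewrite (isog_cyclic (quotient1_isog G)) -P1.
Qed.

End Criterion.

Lemma natr_neq0_prime (k : fieldType) p q :
  has_characteristic k p -> prime q -> q != p -> q%:R != 0 :> k.
Proof.
rewrite /has_characteristic => + q_pr q'p; apply: contraPneq => q0.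
have char_q : q \in [pchar k] by rewrite inE q_pr q0 eqxx.
case: ifP => _; first by move/(_ q); rewrite char_q.
by move/pcharf_eq/(_ q); rewrite char_q inE (negPf q'p).
Qed.

Theorem corollary2p4 (G : finGroupType) (k : fieldType) (p : nat)
    (hk : has_characteristic k p) :
  (exists X Y : gset G, ~ gset_iso X Y /\ linearly_equivalent k X Y)
  <-> ~~ cyclic_mod p [set: G]%G.
Proof.
split=> [[X [Y [nisoXY eqXY]]] | ncycG].
  by apply/negP=> cycG; apply: nisoXY; apply: linearly_equivalent_iso hk cycG eqXY.
(* The obstructions are boolean so that the case split is decidable; the prime is recovered from S
   as the least prime divisor of its order. *)
pose noncyclic (S : {group G}) := let q := pdiv #|S| in
  [&& prime q, q != p, q.-group S & ~~ cyclic S].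
have [/existsP[S /and4P[q_pr q'p qS ncycS]] | cycS] := boolP [exists S, noncyclic S].
  exact: noncyclic_pgroup_relation q_pr (natr_neq0_prime hk q_pr q'p) qS ncycS.
pose noncentral (N : {group G}) g :=
  [&& prime #|N|, #|N| != p, g \in 'N(N) & g \notin 'C(N)].
have [/existsP[N /existsP[g /and4P[N_pr N'p nNg C'g]]] | centN] :=
    boolP [exists N, exists g, noncentral N g].
  exact: nontrivial_action_relation N_pr (natr_neq0_prime hk N_pr N'p) nNg C'g.
case/negP: ncycG; apply: cyclic_mod_criterion => [q S q_pr q'p _ qS | N g N_pr N'p _ _ nNg].
  apply: contraR cycS => ncycS; apply/existsP; exists S.
  have ntS : S :!=: 1%g by apply: contraNneq ncycS => ->; apply: cyclic1.
  have [_ _ [n oS]] := pgroup_pdiv qS ntS.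
  by rewrite /noncyclic oS pdiv_pfactor // q_pr q'p qS ncycS.
apply: contraR centN => C'g; apply/existsP; exists N; apply/existsP; exists g.
exact/and4P.
Qed.
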